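(* Let $X_1,\dots,X_n$ be i.i.d. with distribution $\mathbb{P}\in\mathcal{P}(\mathcal{X})$, let $k\colon\mathcal{X}\times\mathcal{X}\to\mathbb{R}$ be a reproducing kernel, let $\overline{k}=\sup_{x\in\mathcal{X}}k(x,x)$, let $\delta\in(0,1)$, and let $$v = \mathbb{E}_{X\sim\mathbb{P}}\left\| k(X,\cdot)-\mu_{\mathbb{P}}\right\|_{\mathcal{H}_k}^2 .$$ With probability at least $1-\delta$, it holds that $$\max_{1\le t\le n}\left\{ t\left\|\widehat{\mu}_{\mathbb{P}}(X_1,\dots,X_t)-\mu_{\mathbb{P}}\right\|_{\mathcal{H}_k}\right\}\le \sqrt{2vn\log(2/\delta)}+\frac43\sqrt{\overline{k}}\,\log(2/\delta).$$ In particular, with probability at least $1-\delta$, $$\left\|\widehat{\mu}_{\mathbb{P}}(X_1,\dots,X_n)-\mu_{\mathbb{P}}\right\|_{\mathcal{H}_k}\le \sqrt{2v\,\frac{\log(2/\delta)}{n}}+\frac43\sqrt{\overline{k}}\,\frac{\log(2/\delta)}{n}.$$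
   Context: $\mathcal{X}$ is a separable topological space and $\mathcal{P}(\mathcal{X})$ is the set of Borel probability measures on $\mathcal{X}$. The kernel $k$ is a continuous positive definite kernel (in the usual RKHS sense: symmetric with positive semidefinite Gram matrices), bounded in the sense that $\sup_{x\in\mathcal{X}}k(x,x)<\infty$, and $\mathcal{H}_k$ is its reproducing kernel Hilbert space. The kernel mean embedding of $\mathbb{P}$ is the Bochner integral $\mu_{\mathbb{P}}=\mathbb{E}_{X\sim\mathbb{P}}[k(X,\cdot)]\in\mathcal{H}_k$. For a sample, $\widehat{\mu}_{\mathbb{P}}(X_1,\dots,X_t)=\frac1t\sum_{s=1}^t k(X_s,\cdot)\in\mathcal{H}_k$. *)

(* Defs.v *)
From HB Require Import structures.
From mathcomp Require Import all_boot all_order all_algebra.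
From mathcomp Require Import all_classical all_reals all_analysis.

Set Implicit Arguments.
Unset Strict Implicit.
Unset Printing Implicit Defensive.

Import Order.TTheory GRing.Theory Num.Theory.
Import numFieldNormedType.Exports.

Local Open Scope classical_set_scope.
Local Open Scope ring_scope.

Definition separable (X : topologicalType) : Prop :=
  exists D : set X, countable D /\ dense D.

(* The pointedness of [X] is what the library asks of the carrier of a
   generated sigma-algebra; it only says that [X] is nonempty, which the
   existence of a probability measure on [X] implies. *)
Notation borel X := (g_sigma_algebraType (@open X)).

Section Kernels.
Context {R : realType} {X : Type}.
Implicit Type k : X -> X -> R.

(* Positive semidefiniteness of all Gram matrices; repetitions among the
   points are allowed. *)
Definition positive_definite_kernel k : Prop :=
  (forall x y, k x y = k y x) /\
  (forall (m : nat) (x : 'I_m -> X) (c : 'I_m -> R),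
     0 <= \sum_(i < m) \sum_(j < m) c i * c j * k (x i) (x j)).

Definition bounded_kernel k : Prop := has_ubound (range (fun x => k x x)).

Definition kernel_bound k : R := sup (range (fun x => k x x)).

(* A reproducing kernel Hilbert space of [k]: a Banach space whose norm comes
   from an inner product, identified through the injective linear map
   [rkhs_fun] with a space of functions [X -> R], containing all the functions
   [k x] (i.e. k(x, .)), and with the reproducing property.  Such a space
   is unique up to an isometry that respects the functions. *)
Record rkhs k := RKHS {
  rkhs_space :> completeNormedModType R ;
  rkhs_dot : {dot rkhs_space for (@idfun R)} ;
  rkhs_dotE : forall f, rkhs_dot f f = `|f| ^+ 2 ;
  rkhs_fun : rkhs_space -> X -> R ;
  rkhs_fun_linear : forall (a : R) f g x,
    rkhs_fun (a *: f + g) x = a * rkhs_fun f x + rkhs_fun g x ;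
  rkhs_fun_inj : injective rkhs_fun ;
  rkhs_feature : X -> rkhs_space ;
  rkhs_featureE : forall x, rkhs_fun (rkhs_feature x) = k x ;
  rkhs_reproducing : forall f x, rkhs_dot f (rkhs_feature x) = rkhs_fun f x
}.

End Kernels.

Section Bochner.
Context {R : realType} {d : measure_display} {T : measurableType d}
  {V : completeNormedModType R}.
Variable mu : {finite_measure set T -> \bar R}.

Definition vsimple (s : T -> V) : Prop :=
  finite_set (range s) /\ forall y, measurable (s @^-1` [set y]).

Definition vsintegral (s : T -> V) : V :=
  \sum_(y \in range s) fine (mu (s @^-1` [set y])) *: y.

Definition strongly_measurable (f : T -> V) : Prop :=
  exists s : nat -> T -> V, (forall i, vsimple (s i)) /\
    forall x, s i x @[i --> \oo] --> f x.

(* Strong measurability makes the integrands below measurable. *)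
Definition is_bochner_integral (f : T -> V) (I : V) : Prop :=
  strongly_measurable f /\
  exists s : nat -> T -> V,
    [/\ forall i, vsimple (s i),
        (\int[mu]_x `|f x - s i x|%:E)%E @[i --> \oo] --> 0%E
      & vsintegral (s i) @[i --> \oo] --> I].

(* Unspecified when [f] is not Bochner integrable. *)
Definition bochner_integral (f : T -> V) : V := get (is_bochner_integral f).

End Bochner.

Section Independence.
Context {R : realType} {d d' : measure_display} {Omega : measurableType d}
  {T : measurableType d'} (Pr : probability Omega R) {I : finType}.

Definition mutually_independent (Y : I -> {RV Pr >-> T}) : Prop :=
  forall (J : {set I}) (A : I -> set T), (forall i, measurable (A i)) ->
    Pr (\bigcap_(i in [set` J]) Y i @^-1` A i) =
    (\prod_(i in J) Pr (Y i @^-1` A i))%E.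

Definition iid (P : probability T R) (Y : I -> {RV Pr >-> T}) : Prop :=
  (forall i A, measurable A -> distribution Pr (Y i) A = P A) /\
  mutually_independent Y.

End Independence.

Section MeanEmbedding.
Context {R : realType} {X : ptopologicalType} {k : X -> X -> R} (Hk : rkhs k).

Definition mean_embedding (P : probability (borel X) R) : Hk :=
  bochner_integral P (@rkhs_feature _ _ _ Hk : borel X -> Hk).

(* The embedding of the first [t] points of the sample, for [t <= n]. *)
Definition empirical_embedding (n : nat) (x : 'I_n -> X) (t : nat) : Hk :=
  t%:R^-1 *: \sum_(s < n | (s < t)%N) rkhs_feature Hk (x s).

Definition embedding_variance (P : probability (borel X) R) : R :=
  fine ('E_P[fun x : borel X =>
               (`|rkhs_feature Hk x - mean_embedding P| ^+ 2)%R])%E.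

End MeanEmbedding.

(* Main.v *)
Require Import Defs.
From HB Require Import structures.
From mathcomp Require Import all_boot all_order all_algebra.
From mathcomp Require Import all_classical all_reals all_analysis.
From mathcomp Require Import measurable_realfun.
From mathcomp Require Import ring lra.

Set Implicit Arguments.
Unset Strict Implicit.
Unset Printing Implicit Defensive.

Import Order.TTheory GRing.Theory Num.Theory.
Import numFieldNormedType.Exports.

Local Open Scope classical_set_scope.
Local Open Scope ring_scope.

(** The statement is Pinelis' Bernstein inequality for the walk in the Hilbert
    space [Hk] with the bounded centred increments [k(X_s, .) - mu].

    One step.  [coshR (lam * `|s|)] grows slowly along a centred walk: since
    [cosh \o sqrt] is convex (its power series has nonnegative coefficients),
    [coshR `|s + z|] is at most its value at [s], plus a term linear in the inner
    product of [s] and [z], plus [coshR `|s| * (expR `|z| - 1 - `|z|)]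
    ([coshR_normD]).  The linear term averages to zero, and the last one is
    controlled by the variance through [expR_bernstein], so the mean of [coshR]
    after one step is at most [1 + e] times its value before,
    with [e] proportional to the variance ([coshR_normD_mean]).

    Maximum.  For increments taking finitely many values, backward induction on
    the number of remaining steps turns the one-step bound into a bound of
    Ville's type on the probability that some partial sum is longer than [r]
    ([walk_maximal]).  Independence enters only through the product formula for
    the probability of a finite word of values ([word_weight]), so neither
    product measures nor conditional expectations are involved.

    Limit.  [X] is separable and the feature map is continuous, so the feature
    of the nearest of the first [m + 1] points of a dense sequence is a
    finitely valued approximation converging pointwise.  Means converge by the
    contraction property of the Bochner integral, variances by dominated
    convergence, and the event that the maximum is larger than [r] is contained
    in the lower limit of the approximate events, whose probabilities are thus
    bounded in the limit ([iid_chernoff]).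

    Choice of parameters.  With [b = 2 * M] the bound of the increments, the
    optimal [lam] would give the threshold [sqrt (2 v n L) + b L / 3]; the
    second [b L / 3] available in the statement pays for replacing [v] by a
    larger [v'], which absorbs the error on the variances and makes the choice
    of [lam] explicit also when [v = 0] ([iid_bernstein]).  The theorem takes
    [M = sqrt kbar], and its second part is the first one at [t = n]. *)

(** * Scalar inequalities for hyperbolic functions *)

Section Hyperbolic.
Context {R : realType}.
Implicit Types a b c u w x y : R.

Definition coshR x : R := (expR x + expR (- x)) / 2.
Definition sinhR x : R := (expR x - expR (- x)) / 2.

Lemma coshRN x : coshR (- x) = coshR x.
Proof. by rewrite /coshR opprK addrC. Qed.

Lemma coshRD x y : coshR (x + y) = coshR x * coshR y + sinhR x * sinhR y.
Proof. by rewrite /coshR /sinhR opprD !expRD; field. Qed.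

Lemma sinhRN x : sinhR (- x) = - sinhR x.
Proof. by rewrite /sinhR opprK -mulNr opprB. Qed.

Lemma coshR_expR x : coshR x + sinhR x = expR x.
Proof. by rewrite /coshR /sinhR; field. Qed.

Lemma expR_le_coshR x : expR x <= 2 * coshR x.
Proof. by rewrite /coshR mulrCA divff// mulr1 lerDl expR_ge0. Qed.

Lemma coshR_gt0 x : 0 < coshR x.
Proof. by rewrite divr_gt0// addr_gt0// expR_gt0. Qed.

Lemma coshR0 : coshR 0 = 1.
Proof. by rewrite /coshR oppr0 expR0; field. Qed.

Lemma ler_coshR x y : 0 <= x -> x <= y -> coshR x <= coshR y.
Proof.
move=> x0 xy; rewrite /coshR ler_pM2r ?invr_gt0// -subr_ge0.
have -> : expR y + expR (- y) - (expR x + expR (- x)) =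
    (expR y - expR x) * (1 - expR (- (x + y))).
  have ex := expRxMexpNx_1 x; have ey := expRxMexpNx_1 y.
  rewrite [- (x + y)]opprD expRD.
  transitivity (expR y - expR x + expR (- y) * (expR x * expR (- x))
    - expR (- x) * (expR y * expR (- y))); last by ring.
  by rewrite ex ey; ring.
rewrite mulr_ge0// subr_ge0 ?ler_expR//.
by rewrite -expR0 ler_expR oppr_le0 addr_ge0// (le_trans x0).
Qed.

(** Indexed by all degrees, the odd ones contributing zero, so that it lines up
    with [exp_coeff] without reindexing. *)
Definition coshR_coeff x (i : nat) : R := (exp_coeff x i + exp_coeff (- x) i) / 2.

Lemma cvg_series_coshR x : series (coshR_coeff x) @ \oo --> coshR x.
Proof.
have -> : series (coshR_coeff x) =
    (fun n => (series (exp_coeff x) n + series (exp_coeff (- x)) n) / 2).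
  by apply/funext => n; rewrite /series/= -big_split -mulr_suml.
by apply: cvgM (@cvg_cst _ _ _ _ _); apply: cvgD; exact: is_cvg_series_exp_coeff.
Qed.

Lemma coshR_coeffE x i :
  coshR_coeff x i = if odd i then 0 else (x ^+ 2) ^+ i./2 / i`!%:R.
Proof.
rewrite /coshR_coeff /exp_coeff/= exprNn -signr_odd; case: ifPn => [oi|/negPf oi].
  by rewrite expr1 mulN1r mulNr subrr mul0r.
rewrite expr0 mul1r -exprM mul2n.
have -> : i./2.*2 = i by rewrite -[RHS]odd_double_half oi.
by field.
Qed.

Lemma convex_expr (th p q : R) k : 0 <= th <= 1 -> 0 <= p -> 0 <= q ->
  (th * p + (1 - th) * q) ^+ k <= th * p ^+ k + (1 - th) * q ^+ k.
Proof.
move=> /andP[t0 t1] p0 q0; elim: k => [|k ih].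
  by rewrite !expr0 !mulr1 addrC subrK.
have s0 : 0 <= th * p + (1 - th) * q.
  by rewrite addr_ge0// mulr_ge0// subr_ge0.
rewrite exprS (le_trans (ler_wpM2l s0 ih))// -subr_ge0.
have -> : th * p ^+ k.+1 + (1 - th) * q ^+ k.+1 -
    (th * p + (1 - th) * q) * (th * p ^+ k + (1 - th) * q ^+ k) =
    th * (1 - th) * ((p - q) * (p ^+ k - q ^+ k)) by rewrite !exprS; ring.
apply: mulr_ge0; first by rewrite mulr_ge0// subr_ge0.
have [pq|/ltW pq] := leP p q.
  by rewrite mulr_le0// subr_le0// lerXn2r.
by rewrite mulr_ge0// subr_ge0// lerXn2r.
Qed.

(** Convexity of [cosh \o sqrt] on the half-line: its power series in the
    square of the variable has nonnegative coefficients, and each power is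
    convex. *)
Lemma coshR_sqrt_convex (th u1 u2 w : R) : 0 <= th <= 1 ->
  w ^+ 2 = th * u1 ^+ 2 + (1 - th) * u2 ^+ 2 ->
  coshR w <= th * coshR u1 + (1 - th) * coshR u2.
Proof.
move=> th01 wE.
apply: (@ler_cvg_to _ \oo _ _ (series (coshR_coeff w))
  (fun n => th * series (coshR_coeff u1) n + (1 - th) * series (coshR_coeff u2) n)).
- exact: cvg_series_coshR.
- by apply: cvgD; (apply: cvgM; [exact: cvg_cst|exact: cvg_series_coshR]).
apply: nearW => n; rewrite /series/= !mulr_sumr -big_split/= ler_sum// => i _.
rewrite !coshR_coeffE; case: odd; first by rewrite !mulr0 addr0.
rewrite wE [th * (_ / _)]mulrA [(1 - th) * (_ / _)]mulrA -mulrDl.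
rewrite ler_pM2r ?invr_gt0 ?ltr0n ?fact_gt0//.
by rewrite convex_expr// sqr_ge0.
Qed.

Lemma sinhR_ge_id b : 0 <= b -> b <= sinhR b.
Proof.
move=> b0.
(* In the series of [sinhR b], the terms of degree 0 and 1 add up to [b] and
   the others are nonnegative. *)
have : (fun n => (series (exp_coeff b) n - series (exp_coeff (- b)) n) / 2)
    @ \oo --> sinhR b.
  by apply: cvgM (@cvg_cst _ _ _ _ _); apply: cvgB; exact: is_cvg_series_exp_coeff.
move=> /cvgr_to_ge; apply; exists 2%N => // n/= n2.
rewrite ler_pdivlMr// /series/= -sumrB (big_cat_nat (leq0n _) n2)//=.
rewrite big_nat_recr//= big_nat1 /exp_coeff/= !expr0 !expr1 subrr add0r.
rewrite !divr1.
rewrite (_ : b - - b = b * 2); last by ring.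
rewrite lerDl big_nat_cond sumr_ge0// => i _.
rewrite exprNn -signr_odd; case: odd; rewrite ?expr0 ?expr1.
  by rewrite mulN1r mulNr opprK addr_ge0// divr_ge0// exprn_ge0.
by rewrite mul1r subrr.
Qed.

(** The factorials of the exponential series grow at least like [2 * 3 ^ n],
    so the tail of the series is dominated by a geometric one of ratio [c / 3]. *)
Lemma expR_bernstein u c : 0 <= u -> u <= c -> c < 3 ->
  expR u - 1 - u <= u ^+ 2 / (2 * (1 - c / 3)).
Proof.
move=> u0 uc c3.
have c1 : 0 < 1 - c / 3 by lra.
have c0 : 0 <= c / 3 by rewrite divr_ge0// (le_trans u0).
have geo n : \sum_(i < n) (c / 3) ^+ i <= (1 - c / 3)^-1.
  rewrite -[leRHS]mul1r ler_pdivlMr//.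
  rewrite mulrC -opprB mulNr -subrX1 opprB gerBl exprn_ge0//.
have fact3 n : (2 * 3 ^ n <= n.+2`!)%N.
  elim: n => // n ih; rewrite expnS mulnCA factS.
  by rewrite leq_mul.
suff: expR u <= 1 + u + u ^+ 2 / (2 * (1 - c / 3)) by lra.
have /cvgr_to_le := @is_cvg_series_exp_coeff R u; apply.
exists 2%N => // n/= n2; rewrite /series/= (big_cat_nat (leq0n _) n2)//=.
rewrite big_nat_recr//= big_nat1 /exp_coeff/= !expr0 !expr1 !divr1 lerD2l.
rewrite -{1}[2%N]add0n big_addn big_mkord invfM mulrA.
rewrite (le_trans _ (ler_wpM2l _ (geo (n - 2)%N)))//; last first.
  by rewrite divr_ge0// sqr_ge0.
rewrite mulr_sumr ler_sum// => i _.
rewrite addn2 ler_pdivrMr ?ltr0n ?fact_gt0//.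
rewrite (@le_trans _ _ (u ^+ 2 / 2 * (c / 3) ^+ i * (2 * 3 ^ i)%:R))//; last first.
  by rewrite ler_wpM2l ?ler_nat ?fact3// mulr_ge0 ?exprn_ge0// divr_ge0// sqr_ge0.
rewrite natrM natrX expr_div_n [leRHS](_ : _ = u ^+ 2 * c ^+ i).
  by rewrite -addn2 exprD mulrC ler_wpM2l ?exprn_ge0// lerXn2r ?nnegrE// (le_trans u0).
by field; rewrite expf_neq0.
Qed.

(** Here [a], [b] and [w] are the lengths of [s], [z] and [s + z], and [c] is the
    component of [z] along [s].  The left-hand side is convex in [c] by
    [coshR_sqrt_convex] and the right-hand side is affine, so it suffices to
    compare them at [c = b] and [c = - b], where the addition formula leaves a
    multiple of [sinhR b - b]. *)
Lemma coshR_increment a b c w : 0 <= a -> 0 <= b -> `|c| <= b ->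
  w ^+ 2 = a ^+ 2 + 2 * a * c + b ^+ 2 ->
  coshR w <= coshR a + c * sinhR a + coshR a * (expR b - 1 - b).
Proof.
move=> a0 b0 cb wE.
have sb : 0 <= sinhR b - b by rewrite subr_ge0 sinhR_ge_id.
have [b0'|bN0] := eqVneq b 0.
  move: cb; rewrite b0' normr_le0 => /eqP c0.
  have /eqP : w ^+ 2 = a ^+ 2 by rewrite wE b0' c0; ring.
  rewrite eqf_sqr expR0 c0 !subrr mulr0 !addr0 mul0r addr0.
  by move=> /orP[]/eqP->; rewrite ?coshRN.
have bp : 0 < b by rewrite lt_neqAle eq_sym bN0.
(* The weight for which [c] is the mean of [b] and [- b]. *)
pose th := (b + c) / (2 * b).
have th01 : 0 <= th <= 1.
  move: cb; rewrite ler_norml => /andP[c1 c2].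
  apply/andP; split; first by rewrite divr_ge0//; lra.
  by rewrite ler_pdivrMr ?mulr_gt0//; lra.
have cE : c = (2 * th - 1) * b by rewrite /th; field.
rewrite (le_trans (@coshR_sqrt_convex th (a + b) (a - b) w th01 _))//.
  by rewrite wE cE; ring.
rewrite !coshRD coshRN sinhRN cE -coshR_expR -subr_ge0.
set p := coshR a; set q := sinhR a; set s := sinhR b.
have -> : p + (2 * th - 1) * b * q + p * (coshR b + s - 1 - b) -
  (th * (p * coshR b + q * s) + (1 - th) * (p * coshR b + q * - s)) =
  (s - b) * (th * (p - q) + (1 - th) * (p + q)) by ring.
case/andP: th01 => t0 t1.
have pq : 0 <= p - q.
  by rewrite /p /q -(coshRN a) -sinhRN coshR_expR expR_ge0.
have pq' : 0 <= p + q by rewrite coshR_expR expR_ge0.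
by rewrite mulr_ge0// addr_ge0// mulr_ge0// subr_ge0.
Qed.

End Hyperbolic.

(** * Random walks in an inner product space *)

Section InnerProduct.
Context {R : realType} {V : normedModType R} (dot : {dot V for (@idfun R)}).
Hypothesis dotE : forall f, dot f f = `|f| ^+ 2.
Implicit Types (f g s z : V).

Lemma dotC f g : dot f g = dot g f.
Proof. by rewrite hermC expr0 mul1r. Qed.

Lemma dotZl (a : R) f g : dot (a *: f) g = a * dot f g.
Proof. exact: linearZl_LR. Qed.

Lemma dotZr (a : R) f g : dot f (a *: g) = a * dot f g.
Proof. exact: linearZr_LR. Qed.

Lemma normD_sqr f g : `|f + g| ^+ 2 = `|f| ^+ 2 + 2 * dot f g + `|g| ^+ 2.
Proof. by rewrite -!dotE linearDl/= !linearDr/= (dotC g f); ring. Qed.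

Lemma normB_sqr f g : `|f - g| ^+ 2 = `|f| ^+ 2 - 2 * dot f g + `|g| ^+ 2.
Proof. by rewrite normD_sqr normrN linearNr/= mulrN. Qed.

Lemma ler_dot f g : `|dot f g| <= `|f| * `|g|.
Proof.
have [->|f0] := eqVneq f 0; first by rewrite linear0l !normr0 mul0r.
have [->|g0] := eqVneq g 0; first by rewrite linear0r !normr0 mulr0.
have fg0 : 0 < `|f| * `|g| by rewrite mulr_gt0 ?normr_gt0.
(* Expanding the square of the norm of [`|g| f - e `|f| g]; the values 1 and -1
   of [e] give the two bounds. *)
have H e : 0 <= (`|f| * `|g|) * (`|f| * `|g| * (1 + e ^+ 2) - 2 * e * dot f g).
  have := sqr_ge0 (`| `|g| *: f - (e * `|f|) *: g|).
  rewrite normB_sqr !normrZ dotZl dotZr !normr_id.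
  rewrite !exprMn real_normK ?num_real//.
  by congr (0 <= _); ring.
rewrite ler_norml; apply/andP; split.
  by have := H (-1); rewrite pmulr_rge0//; lra.
by have := H 1; rewrite pmulr_rge0//; lra.
Qed.

(** [coshR_increment] in the plane of [s] and [z].  At [s = 0] the quotient is 0,
    as is the inner product. *)
Lemma coshR_normD lam s z : 0 <= lam ->
  coshR (lam * `|s + z|) <= coshR (lam * `|s|)
    + lam * dot s z / `|s| * sinhR (lam * `|s|)
    + coshR (lam * `|s|) * (expR (lam * `|z|) - 1 - lam * `|z|).
Proof.
move=> lam0; apply: coshR_increment; rewrite ?mulr_ge0//.
- have [->|s0] := eqVneq s 0.
    by rewrite linear0l mulr0 mul0r normr0 mulr_ge0.
  rewrite normrM normfV normr_id ler_pdivrMr ?normr_gt0// normrM ger0_norm//.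
  by rewrite -mulrA ler_wpM2l// mulrC ler_dot.
- rewrite !exprMn normD_sqr.
  have [->|s0] := eqVneq s 0; first by rewrite linear0l normr0; ring.
  by field; rewrite normr_eq0.
Qed.

(** The one-step bound of Pinelis: the linear term of [coshR_normD] has mean
    zero because the increments are centred. *)
Lemma coshR_normD_mean (T : finType) (p : T -> R) (z : T -> V) lam b s :
    (forall j, 0 <= p j) -> \sum_j p j = 1 -> \sum_j p j *: z j = 0 ->
    (forall j, `|z j| <= b) -> 0 <= lam -> lam * b < 3 ->
  \sum_j p j * coshR (lam * `|s + z j|) <=
  (1 + lam ^+ 2 * (\sum_j p j * `|z j| ^+ 2) / (2 * (1 - lam * b / 3)))
    * coshR (lam * `|s|).
Proof.
move=> p0 p1 pz zb lam0 lamb.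
set ch := coshR (lam * `|s|); set K := 2 * _.
have step j : p j * coshR (lam * `|s + z j|) <=
    p j * ch + lam / `|s| * sinhR (lam * `|s|) * dot s (p j *: z j)
    + ch * lam ^+ 2 / K * (p j * `|z j| ^+ 2).
  have := ler_wpM2l (p0 j) (coshR_normD s (z j) lam0) => /le_trans; apply.
  rewrite !mulrDr dotZr -/ch; apply: lerD.
    by rewrite lerD2l le_eqVlt; apply/orP; left; apply/eqP; ring.
  have /(ler_wpM2l (ltW (coshR_gt0 (lam * `|s|)))) :
      expR (lam * `|z j|) - 1 - lam * `|z j| <= (lam * `|z j|) ^+ 2 / K.
    by apply: expR_bernstein => //; rewrite ?mulr_ge0// ler_wpM2l.
  move=> /(ler_wpM2l (p0 j)); rewrite -/ch !mulrDr => /le_trans; apply.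
  by rewrite le_eqVlt; apply/orP; left; apply/eqP; ring.
apply: (le_trans (ler_sum _ (fun j _ => step j))).
rewrite !big_split/= -!mulr_suml -!mulr_sumr p1 -linear_sumr/= pz linear0r.
by rewrite le_eqVlt; apply/orP; left; apply/eqP; ring.
Qed.

End InnerProduct.

Lemma big_tupleS {R : nmodType} (T : finType) n (F : n.+1.-tuple T -> R) :
  \sum_w F w = \sum_j \sum_(w : n.-tuple T) F [tuple of j :: w].
Proof.
rewrite (reindex (fun u : T * n.-tuple T => [tuple of u.1 :: u.2])) /=.
  by rewrite pair_bigA.
exists (fun w => (thead w, [tuple of behead w])) => [[j w] _|w _] /=.
  by congr pair; apply/val_inj.
by rewrite [RHS]tuple_eta.
Qed.

Section RandomWalk.
Context {R : realType} {V : normedModType R} {T : finType}.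
Variables (p : T -> R) (z : T -> V).

(** A boolean, so that it can select the words of a finite sum. *)
Definition walk_exceeds (r : R) (s : V) (w : seq T) :=
  [exists t : 'I_(size w).+1, r < `|s + \sum_(j <- take t w) z j|].

Lemma walk_exceeds_nil r s : walk_exceeds r s [::] = (r < `|s|).
Proof.
apply/existsP/idP => [[t]|rs]; first by rewrite /= big_nil addr0.
by exists ord0; rewrite /= big_nil addr0.
Qed.

Lemma walk_exceeds_cons r s j w :
  walk_exceeds r s (j :: w) = (r < `|s|) || walk_exceeds r (s + z j) w.
Proof.
apply/existsP/orP => [[[[|t]/= tw]]|[rs|/existsP[t rt]]].
- by rewrite big_nil addr0; left.
- rewrite big_cons addrA => rt; right; apply/existsP.
  by exists (Ordinal (tw : t < (size w).+1)%N).
- by exists ord0; rewrite /= big_nil addr0.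
- by exists (lift ord0 t); rewrite /= big_cons addrA.
Qed.

Hypotheses (p0 : forall j, 0 <= p j) (p1 : \sum_j p j = 1).

Lemma sum_walk_weights n : \sum_(w : n.-tuple T) \prod_(j <- w) p j = 1.
Proof.
elim: n => [|n ih].
  rewrite (bigD1 [tuple])//= big_nil big1 ?addr0// => w.
  by rewrite (tuple0 w) => /eqP.
rewrite big_tupleS -[RHS]p1; apply: eq_bigr => j _.
rewrite -[RHS]mulr1 -[in RHS]ih mulr_sumr; apply: eq_bigr => w _.
by rewrite big_cons.
Qed.

(** Backward induction on the number of steps, for all starting points at once.
    If the start already lies outside the ball, the probability is at most 1 and
    [coshR (lam * r) <= coshR (lam * `|s|)].  Otherwise the walk takes one step
    and the induction hypothesis at [s + z j] is averaged with [stepC]. *)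
Lemma walk_maximal (C lam r : R) : 0 <= lam -> 0 <= r -> 1 <= C ->
    (forall s, \sum_j p j * coshR (lam * `|s + z j|) <= C * coshR (lam * `|s|)) ->
  forall n s, coshR (lam * r) *
      (\sum_(w : n.-tuple T | walk_exceeds r s w) \prod_(j <- w) p j) <=
    C ^+ n * coshR (lam * `|s|).
Proof.
move=> lam0 r0 C1 stepC n.
have Cn0 m : 0 <= C ^+ m by rewrite exprn_ge0// (le_trans ler01).
have pr0 m (w : m.-tuple T) : 0 <= \prod_(j <- w) p j by rewrite prodr_ge0.
have start m s : r < `|s| -> coshR (lam * r) *
    (\sum_(w : m.-tuple T | walk_exceeds r s w) \prod_(j <- w) p j) <=
    C ^+ m * coshR (lam * `|s|).
  move=> rs; rewrite [leRHS]mulrC; apply: ler_pM => //.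
  - exact/ltW/coshR_gt0.
  - exact: sumr_ge0.
  - by rewrite ler_coshR ?mulr_ge0// ler_wpM2l// ltW.
  - rewrite (le_trans _ (exprn_ege1 m C1))// -[leRHS](sum_walk_weights m).
    rewrite [leRHS](bigID (fun w : m.-tuple T => walk_exceeds r s w))/=.
    by rewrite lerDl sumr_ge0.
elim: n => [|n ih] s; have [rs|sr] := ltP r `|s|; try exact: start.
  rewrite big1 ?mulr0; last first.
    by move=> w; rewrite tuple0 walk_exceeds_nil ltNge sr.
  by rewrite mulr_ge0// ltW// coshR_gt0.
rewrite big_mkcond big_tupleS/=.
rewrite exprSr -mulrA (le_trans _ (ler_wpM2l (Cn0 n) (stepC s)))//.
rewrite !mulr_sumr ler_sum// => j _.
rewrite [leRHS]mulrCA (le_trans _ (ler_wpM2l (p0 j) (ih (s + z j))))//.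
rewrite mulrCA ler_wpM2l ?(ltW (coshR_gt0 _))// mulr_sumr [leRHS]big_mkcond/=.
apply: ler_sum => w _; rewrite walk_exceeds_cons ltNge sr/= big_cons.
by case: ifP.
Qed.

End RandomWalk.

(** * Simple maps and the Bochner integral *)

Section SimpleMaps.
Context {d : measure_display} {T : measurableType d}.

(** The condition of [vsimple] for a target without any structure, so that it
    applies to indices, pairs and words; on vectors it is convertible to
    [vsimple]. *)
Definition simple_map {W : Type} (g : T -> W) : Prop :=
  finite_set (range g) /\ forall y, measurable (g @^-1` [set y]).

Lemma simple_map_preimage {W : Type} (g : T -> W) (Y : set W) :
  simple_map g -> measurable (g @^-1` Y).
Proof.
elim/Pchoice: W => W in g Y *.
move=> [fing mg].
have -> : g @^-1` Y = \bigcup_(y in range g `&` Y) g @^-1` [set y].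
  apply/seteqP; split => [x Yx|x [y [_ Yy]] /= ->//].
  by exists (g x) => //; split => //; exists x.
apply: fin_bigcup_measurable => //.
exact: finite_setIl.
Qed.

Lemma simple_map_comp {W W' : Type} (h : W -> W') (g : T -> W) :
  simple_map g -> simple_map (h \o g).
Proof.
move=> sg; split => [|y]; last exact: (simple_map_preimage (h @^-1` [set y])).
by rewrite -(image_comp g h); apply: finite_image; case: sg.
Qed.

Lemma simple_map_pair {W W' : Type} (g : T -> W) (g' : T -> W') :
  simple_map g -> simple_map g' -> simple_map (fun x => (g x, g' x)).
Proof.
move=> sg sg'; split=> [|[y y']].
  apply: (@sub_finite_set _ _ (range g `*` range g')).
    by move=> _ [x _ <-]; split; exists x.
  by apply: finite_setX; [case: sg|case: sg'].
rewrite (_ : _ @^-1` _ = g @^-1` [set y] `&` g' @^-1` [set y']).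
  by apply: measurableI; apply: simple_map_preimage.
by apply/seteqP; split => x /= [<- <-].
Qed.

Lemma simple_map_measurable {d'} {T' : measurableType d'} (g : T -> T') :
  simple_map g -> measurable_fun setT g.
Proof. by move=> sg _ Y _; rewrite setTI; apply: simple_map_preimage. Qed.

Lemma integral_simple_map {R : realType} (mu : {finite_measure set T -> \bar R})
    {W : choiceType} (g : T -> W) (F : W -> R) (r : seq W) :
  simple_map g -> uniq r -> (forall x, g x \in r) ->
  (\int[mu]_x (F (g x))%:E = (\sum_(y <- r) F y * fine (mu (g @^-1` [set y])))%:E)%E.
Proof.
move=> sg ur gr.
have mg y : measurable (g @^-1` [set y]) by exact: simple_map_preimage.
have indE x : (F (g x))%:E =
    (\sum_(y <- r) (F y)%:E * (\1_(g @^-1` [set y]) x)%:E)%E.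
  rewrite (bigD1_seq (g x))//= indicE mem_set// mule1 big1 ?adde0// => y yx.
  by rewrite indicE memNset ?mule0// => /= gxy; rewrite gxy eqxx in yx.
have ind_int y : mu.-integrable setT (fun x => (\1_(g @^-1` [set y]) x)%:E).
  exact: integrable_indic.
under eq_integral do rewrite indE.
rewrite integral_sum//; last by move=> y; exact: integrableZl.
rewrite -sumEFin; apply: eq_bigr => y _.
rewrite integralZl// integral_indic// setIT EFinM fineK//.
exact: fin_num_measure.
Qed.

End SimpleMaps.

Section Bochner.
Context {R : realType} {d : measure_display} {T : measurableType d}.
Context {V : completeNormedModType R} (dot : {dot V for (@idfun R)}).
Hypothesis dotE : forall f, dot f f = `|f| ^+ 2.
Variable mu : {finite_measure set T -> \bar R}.
Implicit Types (s t f : T -> V).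

Local Notation vsintegral := (vsintegral mu).

(** Computes the integral of [s = F \o g] over the fibres of [g], which may
    be smaller than those of [s].  Both sides have the same inner product with
    every vector, namely a scalar integral. *)
Lemma vsintegralE s (W : choiceType) (g : T -> W) (F : W -> V) (r : seq W) :
  simple_map g -> uniq r -> (forall x, g x \in r) -> s = F \o g ->
  vsintegral s = \sum_(y <- r) fine (mu (g @^-1` [set y])) *: F y.
Proof.
move=> sg ur gr sE.
have ss : simple_map s by rewrite sE; exact: simple_map_comp.
have fs : finite_set (range s) by case: ss.
suff H h : dot (vsintegral s) h =
    dot (\sum_(y <- r) fine (mu (g @^-1` [set y])) *: F y) h.
  apply/eqP; rewrite -subr_eq0 -normr_eq0 -sqrf_eq0 -dotE linearBl/= H.
  by rewrite subrr.
rewrite /Defs.vsintegral fsbig_finite//= !linear_sumlz/=.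
apply: EFin_inj.
under eq_bigr do rewrite dotZl mulrC.
under [in RHS]eq_bigr do rewrite dotZl mulrC.
rewrite -(@integral_simple_map _ _ _ mu _ g (fun y => dot (F y) h))//.
rewrite -(@integral_simple_map _ _ _ mu _ s (fun y => dot y h))//.
  by rewrite sE.
by move=> x; rewrite in_fset_set// mem_set//; exists x.
Qed.

Lemma vsintegral_dist_le s t : vsimple s -> vsimple t ->
  (`|vsintegral s - vsintegral t|%:E <= \int[mu]_x `|s x - t x|%:E)%E.
Proof.
move=> ss st.
pose q x := (s x, t x).
have sq : simple_map q by exact: simple_map_pair.
pose r := finmap.enum_fset (fset_set (range q)).
have ur : uniq r by exact: finmap.fset_uniq.
have qr x : q x \in r.
  by have [fq _] := sq; rewrite in_fset_set// mem_set//; exists x.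
rewrite (vsintegralE (F := fst) sq ur qr)//.
rewrite (vsintegralE (F := snd) sq ur qr)//.
rewrite (@integral_simple_map _ _ _ mu _ q (fun y => `|y.1 - y.2|) r)// lee_fin.
rewrite -sumrB (le_trans (ler_norm_sum _ _ _))// ler_sum// => y _.
by rewrite -scalerBr normrZ mulrC ger0_norm ?fine_ge0.
Qed.

Lemma strongly_measurable_dist f s : strongly_measurable f -> vsimple s ->
  measurable_fun setT (fun x => `|f x - s x|).
Proof.
move=> [t [st tf]] ss.
apply: (@measurable_fun_cvg _ _ _ _ (fun i x => `|t i x - s x|)) => [i|x _].
  apply: simple_map_measurable.
  exact: (simple_map_comp (fun y => `|y.1 - y.2|) (simple_map_pair (st i) ss)).
by apply: cvg_norm; apply: cvgB (tf x) _; exact: cvg_cst.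
Qed.

Lemma vsintegral_dist_le2 f s t : strongly_measurable f -> vsimple s ->
    vsimple t ->
  (`|vsintegral s - vsintegral t|%:E <=
   \int[mu]_x `|f x - s x|%:E + \int[mu]_x `|f x - t x|%:E)%E.
Proof.
move=> mf ss st; apply: (le_trans (vsintegral_dist_le ss st)).
have ms := strongly_measurable_dist mf ss.
have mt := strongly_measurable_dist mf st.
rewrite -ge0_integralD//; try exact/measurable_EFinP.
apply: ge0_le_integral => //.
- apply/measurable_EFinP/simple_map_measurable.
  exact: (simple_map_comp (fun y => `|y.1 - y.2|) (simple_map_pair ss st)).
- by apply: emeasurable_funD; exact/measurable_EFinP.
- move=> x _; rewrite -EFinD lee_fin.
  by rewrite -[in leLHS](subrKA (f x)) (le_trans (ler_normD _ _))// distrC.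
Qed.

Lemma cvg_integral_dist f (s : nat -> T -> V) (M : R) :
    (forall i, vsimple (s i)) -> (forall x, s i x @[i --> \oo] --> f x) ->
    (forall i x, `|s i x| <= M) ->
  (\int[mu]_x `|f x - s i x|%:E)%E @[i --> \oo] --> 0%E.
Proof.
move=> ss sf sM.
have fM x : `|f x| <= M.
  by apply: (cvgr_to_le (cvg_norm (sf x))); exact: nearW.
have mf : strongly_measurable f by exists s.
rewrite [X in _ --> X](_ : _ = \int[mu]_(x in setT) (cst 0%E) x)%E; last first.
  by rewrite integral0.
apply: (@dominated_cvg _ _ _ mu setT measurableT _ _ (cst (2 * M)%:E)) => //.
- by move=> i; apply/measurable_EFinP/strongly_measurable_dist.
- move=> x _; apply: cvg_EFin; first exact: nearW.
  rewrite -(normr0 V) -(subrr (f x)).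
  by apply: cvg_norm; apply: cvgB (sf x); exact: cvg_cst.
- exact: finite_measure_integrable_cst.
- move=> i x _; rewrite /= normr_id lee_fin (le_trans (ler_normB _ _))//.
  by rewrite mulr2n mulrDl mul1r lerD.
Qed.

(** The integrals of the approximations form a Cauchy sequence because the
    integral of simple maps is a contraction for the L1 distance. *)
Lemma bochner_integral_exists f (s : nat -> T -> V) (M : R) :
    (forall i, vsimple (s i)) -> (forall x, s i x @[i --> \oo] --> f x) ->
    (forall i x, `|s i x| <= M) ->
  is_bochner_integral mu f (bochner_integral mu f).
Proof.
move=> ss sf sM.
have mf : strongly_measurable f by exists s.
have I0 := cvg_integral_dist ss sf sM.
suff cI : cvgn (vsintegral \o s).
  by apply: getPex; exists (limn (vsintegral \o s)); split => //; exists s.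
apply: cauchy_cvg; apply: cauchy_exP => e e0.
have e20 : 0 < e / 2 by rewrite divr_gt0.
have /fine_cvgP[finI /cvgrPdist_lt/(_ _ e20) ltI] := I0.
have [N _ HN] : \forall i \near \oo,
    (\int[mu]_x `|f x - s i x|%:E < (e / 2)%:E)%E.
  near=> i.
  have fi : (\int[mu]_x `|f x - s i x|%:E)%E \is a fin_num by near: i.
  rewrite -(fineK fi) lte_fin.
  have : `|0 - fine (\int[mu]_x `|f x - s i x|%:E)%E| < e / 2 by near: i.
  by rewrite sub0r normrN; apply: le_lt_trans; exact: ler_norm.
exists (vsintegral (s N)); exists N => // i /= Ni.
rewrite -ball_normE/= -lte_fin.
apply: (le_lt_trans (vsintegral_dist_le2 mf (ss N) (ss i))).
rewrite [e]splitr EFinD lteD//; apply: HN => //=.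
Unshelve. all: by end_near.
Qed.

(** Any approximating sequence computes the integral: the bound passes to the
    limit along the sequence that witnesses [I]. *)
Lemma vsintegral_dist_bochner f (s : T -> V) I :
  vsimple s -> is_bochner_integral mu f I ->
  (`|vsintegral s - I|%:E <= \int[mu]_x `|f x - s x|%:E)%E.
Proof.
move=> ss [mf [t [st t0 tI]]].
have cvl : (`|vsintegral s - vsintegral (t i)|%:E)%E @[i --> \oo] -->
    `|vsintegral s - I|%:E.
  apply: cvg_EFin; first exact: nearW.
  by apply: cvg_norm; apply: cvgB tI; exact: cvg_cst.
have cvr : (\int[mu]_x `|f x - s x|%:E +
      \int[mu]_x `|f x - t i x|%:E)%E @[i --> \oo] -->
    (\int[mu]_x `|f x - s x|%:E + 0)%E.
  by apply: cvgeD => //; [rewrite fin_num_adde_defl|exact: cvg_cst].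
rewrite adde0 in cvr.
apply: (lee_cvg_to cvl cvr); apply: nearW => i.
exact: vsintegral_dist_le2.
Qed.

End Bochner.

(** * Independent samples of a finitely valued map *)

Section SampleSums.
Context {R : realType} {V : normedModType R}.

(** A conditional sum over all of ['I_n], as in [empirical_embedding], so that
    [t] is an ordinary natural number. *)
Definition partial_sum {T : Type} {n} (f : T -> V) (x : 'I_n -> T) (t : nat) : V :=
  \sum_(s < n | (s < t)%N) f (x s).

Definition max_exceeds {T : Type} {n} (f : T -> V) (r : R) (x : 'I_n -> T) : Prop :=
  exists t : 'I_n.+1, r < `|partial_sum f x t|.

Lemma sum_take_tuple (I : finType) (z : I -> V) n (w : n.-tuple I) t :
  \sum_(j <- take t w) z j = partial_sum z (tnth w) t.
Proof.
elim: n w t => [|n ih] w t; first by rewrite (tuple0 w) /partial_sum big_nil big_ord0.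
case/tupleP: w => j w; rewrite /partial_sum [RHS]big_mkcond [RHS]big_ord_recl/=.
case: t => [|t]; first by rewrite big_nil big1 ?addr0.
rewrite big_cons ltn0Sn; congr (_ + _); rewrite ih -big_mkcond/=.
by apply: eq_bigr => s _; rewrite tnthS.
Qed.

Lemma walk_exceeds_tuple (I : finType) (z : I -> V) r n (w : n.-tuple I) :
  walk_exceeds z r 0 w <-> max_exceeds z r (tnth w).
Proof.
split=> [/existsP[t]|[t]]; rewrite -1?sum_take_tuple.
  rewrite add0r sum_take_tuple => rt.
  by exists (cast_ord (congr1 S (size_tuple w)) t).
move=> rt; apply/existsP.
by exists (cast_ord (congr1 S (esym (size_tuple w))) t); rewrite add0r.
Qed.

End SampleSums.

Section IidSimple.
Context {R : realType} {V : normedModType R} (dot : {dot V for (@idfun R)}).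
Hypothesis dotE : forall f, dot f f = `|f| ^+ 2.
Context {d d' : measure_display} {Omega : measurableType d}
  {T : measurableType d'} (Pr : probability Omega R) (P : probability T R).
Variables (n : nat) (Xs : 'I_n -> {RV Pr >-> T}).
Hypothesis Xs_iid : iid P Xs.

Variables (I : finType) (h : T -> I) (sh : simple_map h).
Let p j := fine (P (h @^-1` [set j])).

Let word (w : Omega) : n.-tuple I := [tuple h (Xs s w) | s < n].

Lemma word_fiber (y : n.-tuple I) : word @^-1` [set y] =
  \bigcap_(s in [set` [set: 'I_n]%SET]) Xs s @^-1` (h @^-1` [set tnth y s]).
Proof.
apply/seteqP; split => [w /= <- s _ /=|w H]; first by rewrite tnth_mktuple.
by apply: eq_from_tnth => s; rewrite tnth_mktuple; apply: H; rewrite /= inE.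
Qed.

Lemma simple_map_word : simple_map word.
Proof.
split=> [|y]; first exact: finite_finset.
rewrite word_fiber; apply: fin_bigcap_measurable => // s _.
rewrite -[X in measurable X]setTI; apply: measurable_funP => //.
exact: simple_map_preimage.
Qed.

(** The only use of independence: the probability of a word is the product of
    the probabilities of its letters. *)
Lemma word_weight (y : n.-tuple I) :
  fine (Pr (word @^-1` [set y])) = \prod_(j <- y) p j.
Proof.
case: Xs_iid => XsP Xs_indep.
have mh j : measurable (h @^-1` [set j]) by exact: simple_map_preimage.
rewrite word_fiber (Xs_indep [set: 'I_n]%SET (fun s => h @^-1` [set tnth y s]))//.
rewrite (big_tuple _ _ y) -[RHS]/(fine (_%:E)) -prodEFin; congr fine.
apply: eq_big => [s|s _]; first by rewrite inE.
rewrite /p fineK; last exact: fin_num_measure.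
by rewrite -(XsP s).
Qed.

Lemma iid_simple_prob (Y : pred (n.-tuple I)) :
  Pr [set w | Y (word w)] = (\sum_(y : n.-tuple I | Y y) \prod_(j <- y) p j)%:E.
Proof.
have sp := simple_map_word.
rewrite -[[set w | _]]setIT -integral_indic//=; last first.
  exact: (simple_map_preimage [set y | Y y] sp).
have intE := @integral_simple_map _ _ _ Pr _ word (fun y => (Y y)%:R) _ sp
  (index_enum_uniq _) (fun w => mem_index_enum (word w)).
apply: etrans (etrans intE _).
  apply: eq_integral => w _; rewrite indicE; congr (_%:R%:E).
  by congr nat_of_bool; apply/idP/idP => [/set_mem//|Yw]; rewrite mem_set.
congr EFin; rewrite [RHS]big_mkcond; apply: eq_bigr => y _.
apply: etrans (congr1 (fun q => (Y y)%:R * q) (word_weight y)) _.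
by case: ifP; rewrite ?mul1r ?mul0r.
Qed.

Lemma iid_simple_weights : (forall j, 0 <= p j) /\ \sum_j p j = 1.
Proof.
split=> [j|]; first by rewrite fine_ge0.
have := @integral_simple_map _ _ _ P _ h (fun=> 1) _ sh
  (index_enum_uniq _) (fun w => mem_index_enum (h w)).
rewrite integral_cst// mul1e [X in X = _](_ : _ = 1%E); last exact: probability_setT.
move=> -[->].
by apply: eq_bigr => j _; rewrite mul1r.
Qed.

(** [walk_maximal] started at the origin, where [coshR] is 1, combined with
    [expR x <= 2 * coshR x] and [1 + e <= expR e]. *)
Lemma iid_simple_maximal (z : I -> V) (b lam r v : R) :
    \sum_j p j *: z j = 0 -> (forall j, `|z j| <= b) ->
    \sum_j p j * `|z j| ^+ 2 <= v -> 0 <= lam -> lam * b < 3 -> 0 <= r ->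
  (Pr [set w | max_exceeds (z \o h) r (fun s => Xs s w)] <=
   (2 * expR (lam ^+ 2 * v / (2 * (1 - lam * b / 3)) *+ n - lam * r))%:E)%E.
Proof.
move=> pz zb zv lam0 lamb r0.
have [p0 p1] := iid_simple_weights.
set e := lam ^+ 2 * v / _.
have K0 : 0 < 2 * (1 - lam * b / 3) by lra.
have e0 : 0 <= e.
  rewrite divr_ge0 ?(ltW K0)// mulr_ge0 ?sqr_ge0// (le_trans _ zv)// sumr_ge0//.
  by move=> j _; rewrite mulr_ge0 ?sqr_ge0.
have step s : \sum_j p j * coshR (lam * `|s + z j|) <= (1 + e) * coshR (lam * `|s|).
  apply: le_trans (coshR_normD_mean dotE s p0 p1 pz zb lam0 lamb) _.
  rewrite ler_wpM2r ?(ltW (coshR_gt0 _))// lerD2l ler_wpM2r ?invr_ge0 ?(ltW K0)//.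
  by rewrite ler_wpM2l ?sqr_ge0.
have := walk_maximal p0 p1 lam0 r0 _ step.
rewrite lerDl => /(_ e0 n 0); rewrite normr0 mulr0 coshR0 mulr1 => walk.
rewrite (_ : [set w | _] = [set w | walk_exceeds z r 0 (word w)]); last first.
  apply/seteqP; split => w /=; rewrite (walk_exceeds_tuple z r (word w)) => -[t].
    move=> rt; exists t; move: rt; rewrite /partial_sum.
    by under [in X in _ -> X]eq_bigr do rewrite tnth_mktuple.
  move=> rt; exists t; move: rt; rewrite /partial_sum.
  by under eq_bigr do rewrite tnth_mktuple.
rewrite (iid_simple_prob (fun y => walk_exceeds z r 0 y)) lee_fin.
set q := \sum_(y | _) _ in walk *.
have q0 : 0 <= q by rewrite sumr_ge0// => y _; rewrite prodr_ge0.
have eC : (1 + e) ^+ n <= expR (e *+ n).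
  by rewrite -mulr_natl expRM_natl lerXn2r ?nnegrE ?expR_ge0 ?expR_ge1Dx// addr_ge0.
rewrite expRB mulrA ler_pdivlMr ?expR_gt0//.
rewrite (le_trans (ler_wpM2l q0 (expR_le_coshR _)))// mulrCA ler_pM2l// mulrC.
exact: le_trans eC.
Qed.

End IidSimple.

(** * Independent samples of a bounded map *)

(** Fatou's lemma for sets, in the form of a bound: [E] is contained in the
    increasing union of the intersections of the tails of [F]. *)
Lemma measure_le_eventually {R : realType} {d} {T : measurableType d}
    (mu : {measure set T -> \bar R}) (E : set T) (F : (set T)^nat) (B : \bar R) :
    measurable E -> (forall i, measurable (F i)) ->
    (forall x, E x -> \forall i \near \oo, F i x) ->
    (\forall i \near \oo, (mu (F i) <= B)%E) ->
  (mu E <= B)%E.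
Proof.
move=> mE mF EF [N _ FB].
pose U i := \bigcap_(j in [set j | (i <= j)%N]) F j.
have mU i : measurable (U i) by apply: bigcap_measurable => //; exists i => /=.
have mUU : measurable (\bigcup_i U i) by exact: bigcup_measurable.
have EU : E `<=` \bigcup_i U i.
  move=> x /EF[i _ iF]; exists i => // j /= ij; exact: iF.
apply: (@le_trans _ _ (mu (\bigcup_i U i))).
  by apply: le_measure; rewrite ?inE.
have ndU : {homo U : n m / (n <= m)%N >-> (n <= m)%O}.
  move=> i j ij; apply/subsetPset => x Ux k /= jk; apply: Ux => /=.
  exact: leq_trans jk.
have cU := @nondecreasing_cvg_mu _ _ _ mu _ mU mUU ndU.
apply: (lee_cvg_to cU (cvg_cst B)).
apply: nearW => i /=; apply: (@le_trans _ _ (mu (F (maxn i N)))).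
  by apply: le_measure; rewrite ?inE// => x; apply => /=; exact: leq_maxl.
by apply: FB => /=; exact: leq_maxr.
Qed.

Lemma simple_map_sum {d} {T : measurableType d} {V : zmodType} {I : Type}
    (r : seq I) (Q : pred I) (g : I -> T -> V) :
  (forall i, simple_map (g i)) -> simple_map (fun x => \sum_(i <- r | Q i) g i x).
Proof.
move=> sg; elim: r => [|i r ih].
  under eq_fun do rewrite big_nil.
  split=> [|y].
    by apply: (@sub_finite_set _ _ [set 0]) => // _ [x _ <-].
  by rewrite preimage_cst; case: ifP.
under eq_fun do rewrite big_cons; case: (Q i) => //.
exact: (simple_map_comp (fun y => y.1 + y.2) (simple_map_pair (sg i) ih)).
Qed.

Lemma cvg_partial_sum {R : realType} {V : normedModType R} {T : Type} n
    (F : nat -> T -> V) (G : T -> V) (x : 'I_n -> T) t :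
  (forall y, F i y @[i --> \oo] --> G y) ->
  partial_sum (F i) x t @[i --> \oo] --> partial_sum G x t.
Proof. by move=> FG; apply: cvg_big => [|s _]; [exact: add_continuous|exact: FG]. Qed.

Section Sample.
Context {R : realType} {V : completeNormedModType R}.
Context {d d' : measure_display} {Omega : measurableType d}
  {T : measurableType d'} (Pr : probability Omega R).
Variables (n : nat) (Xs : 'I_n -> {RV Pr >-> T}).
Local Notation sample w := (fun s => Xs s w).

Lemma simple_map_RV {W : Type} (h : T -> W) s : simple_map h ->
  simple_map (h \o Xs s).
Proof.
move=> [fh mh]; split=> [|y].
  by apply: sub_finite_set fh => _ [w _ <-]; exists (Xs s w).
rewrite -[X in measurable X]setTI; exact: (measurable_funP (Xs s) measurableT _ (mh y)).
Qed.

Lemma measurable_norm_partial_sum (F : T -> V) t : strongly_measurable F ->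
  measurable_fun setT (fun w => `|partial_sum F (sample w) t|).
Proof.
move=> [G [sG GF]].
apply: (@measurable_fun_cvg _ _ _ _
    (fun i w => `|partial_sum (G i) (sample w) t|)) => [i|w _].
  apply: simple_map_measurable.
  apply: (@simple_map_comp _ _ _ _ (fun y : V => `|y|)).
  by apply: simple_map_sum => s; exact: (simple_map_RV s (sG i)).
by apply: cvg_norm; exact: cvg_partial_sum.
Qed.

Lemma measurable_max_exceeds (F : T -> V) r : strongly_measurable F ->
  measurable [set w | max_exceeds F r (sample w)].
Proof.
move=> mF.
rewrite (_ : [set w | _] = \bigcup_(t in [set: 'I_n.+1])
    [set w | r < `|partial_sum F (sample w) t|]); last first.
  by apply/seteqP; split => w [t]; exists t.
apply: fin_bigcup_measurable => // t _.
rewrite (_ : [set w | _] = setT `&`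
    (fun w => `|partial_sum F (sample w) t|) @^-1` `]r, +oo[%classic).
  exact: measurable_norm_partial_sum.
by rewrite setTI; apply/seteqP; split => w /=; rewrite in_itv/= andbT.
Qed.

End Sample.

Section BoundedIid.
Context {R : realType} {V : completeNormedModType R} (dot : {dot V for (@idfun R)}).
Hypothesis dotE : forall f, dot f f = `|f| ^+ 2.
Context {d d' : measure_display} {Omega : measurableType d}
  {T : measurableType d'} (Pr : probability Omega R) (P : probability T R).
Variables (n : nat) (Xs : 'I_n -> {RV Pr >-> T}).
Hypothesis Xs_iid : iid P Xs.
Variables (f : T -> V) (a : nat -> V) (g : nat -> T -> nat) (M : R).
Hypotheses (sg : forall m, simple_map (g m)) (gm : forall m x, (g m x <= m)%N).
Hypothesis gf : forall x, a (g m x) @[m --> \oo] --> f x.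
Hypothesis aM : forall j, `|a j| <= M.

(** [g m] selects one of the first [m + 1] points of [a]; [hs] is the same
    selection with values in a finite type, as the finite inequality requires,
    and [fs] is the resulting approximation of [f], of mean [mus]. *)
Let fs m x := a (g m x).
Let mu := bochner_integral P f.
Let mus m := vsintegral P (fs m).
Let hs m x : 'I_m.+1 := inord (g m x).
Let p m j := fine (P (hs m @^-1` [set j])).
Arguments p : clear implicits.

Let vs m : vsimple (fs m).
Proof. exact: (simple_map_comp a (sg m)). Qed.

Let shs m : simple_map (hs m).
Proof. exact: (simple_map_comp inord (sg m)). Qed.

Let mf : strongly_measurable f.
Proof. by exists fs. Qed.

Lemma bounded_limit x : `|f x| <= M.
Proof. by apply: (cvgr_to_le (cvg_norm (@gf x))); exact: nearW. Qed.

Let M0 : 0 <= M. Proof. exact: le_trans (aM 0). Qed.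

Let fs_index m : fs m = (fun j : 'I_m.+1 => a j) \o hs m.
Proof. by apply/funext => x; rewrite /fs/= inordK// ltnS. Qed.

Lemma mus_weights m : mus m = \sum_j p m j *: a j.
Proof.
exact: (vsintegralE dotE P (shs m) (index_enum_uniq _)
  (fun x => mem_index_enum (hs m x)) (fs_index m)).
Qed.

Lemma mus_bound m : `|mus m| <= M.
Proof.
have [p0 p1] := iid_simple_weights P (shs m).
rewrite mus_weights (le_trans (ler_norm_sum _ _ _))//.
rewrite -[M]mul1r -[X in X * M]p1 mulr_suml ler_sum// => j _.
by rewrite normrZ ger0_norm ?ler_wpM2l// p0.
Qed.

Lemma cvg_mus : mus m @[m --> \oo] --> mu.
Proof.
have Imu : is_bochner_integral P f mu.
  by apply: (bochner_integral_exists dotE P (M := M) vs) => [x|i x];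
    [exact: gf|exact: aM].
have I0 := @cvg_integral_dist _ _ _ _ P f fs M vs (@gf) (fun i x => aM _).
apply/cvgrPdist_lt => e e0.
have /fine_cvgP[finI /cvgrPdist_lt/(_ _ e0) ltI] := I0.
near=> m.
have fi : (\int[P]_x `|f x - fs m x|%:E)%E \is a fin_num by near: m.
rewrite distrC -lte_fin.
apply: (le_lt_trans (vsintegral_dist_bochner dotE (vs m) Imu)).
rewrite -(fineK fi) lte_fin.
have : `|0 - fine (\int[P]_x `|f x - fs m x|%:E)%E| < e by near: m.
by rewrite sub0r normrN; apply: le_lt_trans; exact: ler_norm.
Unshelve. all: by end_near.
Qed.

Lemma mu_bound : `|mu| <= M.
Proof.
by apply: (cvgr_to_le (cvg_norm cvg_mus)); apply: nearW => m; exact: mus_bound.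
Qed.

Let v := fine (\int[P]_x (`|f x - mu| ^+ 2)%:E)%E.

Lemma cvg_variance :
  (\sum_j p m j * `|a j - mus m| ^+ 2) @[m --> \oo] --> v.
Proof.
have -> : (fun m => \sum_j p m j * `|a j - mus m| ^+ 2) =
    (fun m => fine (\int[P]_x (`|fs m x - mus m| ^+ 2)%:E)%E).
  apply/funext => m; rewrite fs_index.
  rewrite (@integral_simple_map _ _ _ P _ (hs m) (fun j => `|a j - mus m| ^+ 2)
    _ (shs m) (index_enum_uniq _) (fun w => mem_index_enum (hs m w)))/=.
  by apply: eq_bigr => j _; rewrite mulrC.
have c2 m x : `|fs m x - mus m| ^+ 2 <= (2 * M) ^+ 2.
  rewrite lerXn2r ?nnegrE ?mulr_ge0// (le_trans (ler_normB _ _))//.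
  by rewrite mulr2n mulrDl mul1r lerD// ?mus_bound// aM.
have cfs x : (`|fs m x - mus m| ^+ 2) @[m --> \oo] --> `|f x - mu| ^+ 2.
  have cn : `|fs m x - mus m| @[m --> \oo] --> `|f x - mu|.
    by apply: cvg_norm; apply: cvgB (@gf x) cvg_mus.
  by rewrite expr2; under eq_fun do rewrite expr2; exact: cvgM.
have mfs m : measurable_fun setT (fun x => `|fs m x - mus m| ^+ 2).
  apply: simple_map_measurable.
  exact: (simple_map_comp (fun y => `|y - mus m| ^+ 2) (vs m)).
have mfmu : measurable_fun setT (fun x => `|f x - mu| ^+ 2).
  by apply: (measurable_fun_cvg mfs) => x _; exact: cfs.
have [] := @dominated_convergence _ _ _ P setT measurableT
  (fun m x => (`|fs m x - mus m| ^+ 2)%:E) (fun x => (`|f x - mu| ^+ 2)%:E)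
  (cst ((2 * M) ^+ 2)%:E).
- by move=> m; exact/measurable_EFinP.
- exact/measurable_EFinP.
- by apply: aeW => x _; apply: cvg_EFin; [exact: nearW|exact: cfs].
- exact: finite_measure_integrable_cst.
- by apply: aeW => x m _; rewrite /= lee_fin ger0_norm ?sqr_ge0.
move=> fint _ cint.
by apply: fine_cvg; rewrite fineK ?(integrable_fin_num measurableT fint).
Qed.

(** The finite inequality is applied to the centred approximations.  Their
    variances need not stay below [v], but they are eventually below any larger
    [v']. *)
Lemma iid_chernoff (lam r v' : R) : v < v' ->
    0 <= lam -> lam * (2 * M) < 3 -> 0 <= r ->
  (Pr [set w | max_exceeds (fun x => (f x - mu)%R) r (fun s => Xs s w)] <=
   (2 * expR (lam ^+ 2 * v' / (2 * (1 - lam * (2 * M) / 3)) *+ n - lam * r))%:E)%E.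
Proof.
move=> vv' lam0 lamM r0.
have cfs c cs x : cs @ \oo --> c -> fs m x - cs m @[m --> \oo] --> f x - c.
  exact: cvgB (@gf x).
have sfs m c : simple_map (fun x => fs m x - c).
  exact: (simple_map_comp (fun y => y - c) (vs m)).
apply: (@measure_le_eventually _ _ _ Pr _
  (fun m => [set w | max_exceeds (fun x => fs m x - mus m) r (fun s => Xs s w)])).
- apply: measurable_max_exceeds; exists (fun m x => fs m x - mu).
  by split=> [m|x]; [exact: sfs|apply: cfs; exact: cvg_cst].
- move=> m; apply: measurable_max_exceeds; exists (fun _ x => fs m x - mus m).
  by split=> [_|x]; [exact: sfs|exact: cvg_cst].
- move=> w [t rt].
  have cw := cvg_norm (@cvg_partial_sum _ _ _ n (fun m x => fs m x - mus m)
    (fun x => f x - mu) (fun s => Xs s w) t (fun x => cfs _ _ x cvg_mus)).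
  have [N _ rN] := cvgr_gt _ (cw _) _ rt.
  by exists N => // m Nm; exists t; exact: rN.
have [N _ vN] := cvgr_lt _ cvg_variance _ vv'.
exists N => // m /vN/= vm.
have [p0 p1] := iid_simple_weights P (shs m).
rewrite (_ : (fun x => fs m x - mus m) = (fun j : 'I_m.+1 => a j - mus m) \o hs m).
  apply: (iid_simple_maximal dotE Xs_iid (shs m)) => //; last exact: ltW.
    under eq_bigr do rewrite scalerBr.
    by rewrite sumrB -scaler_suml p1 scale1r -mus_weights subrr.
  move=> j; rewrite (le_trans (ler_normB _ _))//.
  by rewrite mulr2n mulrDl mul1r lerD// ?mus_bound// aM.
by rewrite fs_index.
Qed.

(** With [c = 2 M / 3], [q = sqrt (2 v n L)] and [q' = q + c L], the threshold
    is [q' + c L].  Taking for [v'] the variance for which [q'] is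
    [sqrt (2 v' n L)], the optimal parameter is [lam = 2 L / (q' + 2 c L)], and
    the exponent of [iid_chernoff] is then exactly [- L]. *)
Lemma iid_bernstein (L : R) : (0 < n)%N -> 0 < L ->
  (Pr [set w | max_exceeds (fun x => (f x - mu)%R)
        (Num.sqrt (2 * v * n%:R * L) + 4 / 3 * M * L) (fun s => Xs s w)] <=
   (2 * expR (- L))%:E)%E.
Proof.
move=> n0 L0.
(* If [M] is 0 then so is [f], and [v'] would not exceed [v]. *)
have [Mp|M0'] := ltP 0 M; last first.
  have z0 z : `|z| <= M -> z = 0 :> V.
    by move=> zM; apply/eqP; rewrite -normr_le0 (le_trans zM).
  rewrite (_ : [set w | _] = set0) ?measure0 ?lee_fin ?mulr_ge0 ?expR_ge0//.
  apply/seteqP; split=> // w [t]; apply/negP; rewrite -leNgt.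
  rewrite /partial_sum big1 => [|s _]; last first.
    by rewrite (z0 _ (bounded_limit _)) (z0 _ mu_bound) subrr.
  by rewrite normr0 addr_ge0 ?sqrtr_ge0// !mulr_ge0// ltW.
have nR : 0 < n%:R :> R by rewrite ltr0n.
have v0 : 0 <= v by rewrite fine_ge0// integral_ge0.
set q := Num.sqrt _.
have q0 : 0 <= q by exact: sqrtr_ge0.
have q2 : q ^+ 2 = 2 * v * n%:R * L.
  by rewrite sqr_sqrtr// !mulr_ge0// ltW.
pose c := 2 * M / 3.
have c0 : 0 < c by rewrite divr_gt0// mulr_gt0.
have cL0 : 0 < c * L by rewrite mulr_gt0.
pose q' := q + c * L.
have q'0 : 0 < q' by rewrite /q'; lra.
pose v' := q' ^+ 2 / (2 * n%:R * L).
pose lam := 2 * L / (q' + 2 * (c * L)).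
have D0 : 0 < q' + 2 * (c * L) by lra.
have vv' : v < v'.
  rewrite ltr_pdivlMr ?mulr_gt0// (_ : v * _ = q ^+ 2); last by rewrite q2; ring.
  by rewrite ltrXn2r// /q'; lra.
have lam0 : 0 <= lam by rewrite divr_ge0 ?mulr_ge0 ?ltW.
have lamc : lam * c < 1.
  rewrite /lam mulrAC ltr_pdivrMr// mul1r; move: q'0 => /[dup]; lra.
have r0 : 0 <= q + 4 / 3 * M * L.
  by rewrite addr_ge0// !mulr_ge0// ltW.
have lamM : lam * (2 * M) < 3 by move: lamc; rewrite /c; lra.
apply: le_trans (iid_chernoff vv' lam0 lamM r0) _.
rewrite lee_fin ler_pM2l// ler_expR le_eqVlt; apply/orP; left; apply/eqP.
have -> : q + 4 / 3 * M * L = q' + c * L by rewrite /q' /c; field.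
have -> : lam * (2 * M) / 3 = lam * c by rewrite /c; ring.
rewrite -mulr_natr /v' /lam.
field.
rewrite (_ : _ - 2 * L * c = q'); last by ring.
by rewrite !gt_eqF.
Qed.

End BoundedIid.

(** * Discretising a separable feature map *)

Section NearestPoint.
Context {R : realType} {V : normedModType R}.
Context {d : measure_display} {T : measurableType d}.
Variables (f : T -> V) (a : nat -> V).

(** The index of the first of the points nearest to [f x] among
    [a 0], ..., [a m]; ties keep the smaller index, so that the choice depends
    on finitely many comparisons of measurable functions. *)
Fixpoint nearest (m : nat) (x : T) : nat :=
  if m is k.+1 then
    if `|f x - a m| < `|f x - a (nearest k x)| then m else nearest k x
  else 0.

Lemma nearest_le m x : (nearest m x <= m)%N.
Proof. by elim: m => //= m ih; case: ifP => // _; exact: leqW. Qed.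

Lemma nearest_dist m x j : (j <= m)%N ->
  `|f x - a (nearest m x)| <= `|f x - a j|.
Proof.
elim: m => [|m ih]; first by rewrite leqn0 => /eqP->.
rewrite leq_eqVlt => /predU1P[->|/ih {}ih] /=; case: ltP => // /ltW lt.
exact: le_trans ih.
Qed.

Lemma cvg_nearest x : (forall e, 0 < e -> exists j, `|f x - a j| < e) ->
  a (nearest m x) @[m --> \oo] --> f x.
Proof.
move=> ax; apply/cvgrPdist_lt => e /ax[j je].
by exists j => // m /= jm; apply: le_lt_trans je; exact: nearest_dist.
Qed.

(** Measurability of the selection and of the distance to the selected point
    are proved together, since each step of the recursion compares the latter
    with the distance to a new point. *)
Lemma simple_map_nearest m :
  (forall y, measurable_fun setT (fun x => `|f x - y|)) ->
  simple_map (nearest m).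
Proof.
move=> mf.
suff [mnear _] : measurable_fun setT (nearest m) /\
    measurable_fun setT (fun x => `|f x - a (nearest m x)|).
  split=> [|y]; last by rewrite -[X in measurable X]setTI; exact: mnear.
  apply: (@sub_finite_set _ _ `I_m.+1) => // _ [x _ <-] /=.
  by rewrite ltnS nearest_le.
elim: m => [|m [ihn ihd]] /=; first by split => //; exact: measurable_cst.
have mb : measurable_fun setT
    (fun x => `|f x - a m.+1| < `|f x - a (nearest m x)|).
  exact: measurable_fun_ltr.
split; first by apply: measurable_fun_ifT.
under eq_fun do rewrite (fun_if (fun j => `|f _ - a j|)).
exact: measurable_fun_ifT.
Qed.

End NearestPoint.

Lemma continuous_borel_measurable {R : realType} {X : ptopologicalType}
    (h : X -> R) :
  continuous h -> measurable_fun setT (h : borel X -> R).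
Proof.
move=> /continuousP ch.
apply: (measurability _ (RGenOpens.measurableE R)) => _ [_ [a [b ->]] <-].
rewrite setTI; apply: sub_sigma_algebra; apply: ch; exact: interval_open.
Qed.

Lemma separable_dense_seq (X : ptopologicalType) : separable X ->
  exists x : nat -> X, dense (range x).
Proof.
move=> [D [cD dD]].
have [D0|[x]] := pfcard_geP cD.
  have [] := dD setT; first by exists point.
    exact: openT.
  by rewrite D0 => y [].
exists x => O O0 oO; have [y [Oy Dy]] := dD O O0 oO.
by exists y; split => //; exact: (surj Dy).
Qed.

Section Feature.
Context {R : realType} {X : ptopologicalType} {k : X -> X -> R} (Hk : rkhs k).
Local Notation phi := (rkhs_feature Hk).

Lemma feature_dot x y : rkhs_dot Hk (phi x) (phi y) = k x y.
Proof. by rewrite rkhs_reproducing rkhs_featureE. Qed.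

Lemma norm_feature_le x : bounded_kernel k ->
  `|phi x| <= Num.sqrt (kernel_bound k).
Proof.
move=> bk; have kx : k x x <= kernel_bound k.
  by apply: ub_le_sup => //; exists x.
rewrite -(ger0_norm (normr_ge0 (phi x))) -sqrtr_sqr ler_wsqrtr//.
by rewrite -rkhs_dotE feature_dot.
Qed.

(** By the reproducing property,
    [`|phi x - phi y| ^+ 2 = k x x - 2 * k x y + k y y]. *)
Lemma continuous_feature :
  continuous (fun z : X * X => k z.1 z.2) -> continuous phi.
Proof.
move=> ck x; apply/cvgrPdist_lt => e e0.
have ckx (g h : X -> X) : g y @[y --> x] --> g x -> h y @[y --> x] --> h x ->
    k (g y) (h y) @[y --> x] --> k (g x) (h x).
  by move=> gx hx; apply: (cvg_comp2 gx hx (ck (g x, h x))).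
have : k x x - 2 * k x y + k y y @[y --> x] --> k x x - 2 * k x x + k x x.
  apply: cvgD; last by apply: (ckx id id).
  apply: cvgB; first exact: cvg_cst.
  by apply: cvgM; [exact: cvg_cst|apply: (ckx (cst x) id) => //; exact: cvg_cst].
have e20 : 0 < e ^+ 2 by rewrite exprn_gt0.
rewrite (_ : _ - _ + _ = 0); last by ring.
move=> /cvgr_lt/(_ _ e20); apply: filterS => y /= kxy.
rewrite -(ltr_pXn2r (ltn0Sn 1)) ?nnegrE ?(ltW e0)//.
by rewrite (normB_sqr (@rkhs_dotE _ _ _ Hk)) -!rkhs_dotE !feature_dot.
Qed.

End Feature.

(** * Concentration of kernel mean embeddings *)

Lemma partial_sum_subcst {R : realType} {V : normedModType R} {T : Type} n
    (F : T -> V) (c : V) (x : 'I_n -> T) t : (t <= n)%N ->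
  partial_sum (fun y => F y - c) x t = partial_sum F x t - t%:R *: c.
Proof.
move=> tn; rewrite /partial_sum sumrB; congr (_ - _).
by rewrite -(big_ord_widen n (fun=> c) tn) sumr_const card_ord scaler_nat.
Qed.

Lemma approximable_feature {R : realType} {X : ptopologicalType}
    {k : X -> X -> R} (Hk : rkhs k) : separable X ->
    continuous (fun z : X * X => k z.1 z.2) ->
  exists (a : nat -> X) (g : nat -> borel X -> nat),
    [/\ forall m, simple_map (g m), forall m x, (g m x <= m)%N &
        forall x : borel X,
          rkhs_feature Hk (a (g m x)) @[m --> \oo] --> rkhs_feature Hk x].
Proof.
move=> sX ck; have [a da] := separable_dense_seq sX.
have cphi := @continuous_feature _ _ _ Hk ck.
pose phi : borel X -> Hk := rkhs_feature Hk.
exists a, (nearest phi (rkhs_feature Hk \o a)); split=> [m|m x|x].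
- apply: simple_map_nearest => y.
  apply: (@continuous_borel_measurable _ _ (fun x => `|rkhs_feature Hk x - y|)) => x.
  by apply: cvg_norm; apply: cvgB (cphi x) _; exact: cvg_cst.
- exact: nearest_le.
- apply: (@cvg_nearest _ _ _ _ phi (rkhs_feature Hk \o a)) => e e0.
  pose S := rkhs_feature Hk @^-1` ball (phi x) e.
  have S0 : S !=set0 by exists x; exact: ballxx.
  have oS : open S.
    by apply: open_comp => [? _|]; [exact: cphi|exact: ball_open].
  have [z [Sz [j _ jz]]] := da S S0 oS.
  by exists j; move: Sz; rewrite -jz /S/= -ball_normE.
Qed.

Theorem theorem2p1 (R : realType) (X : ptopologicalType)
    (X_separable : separable X)
    (k : X -> X -> R)
    (k_continuous : continuous (fun z : X * X => k z.1 z.2))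
    (k_pd : positive_definite_kernel k)
    (k_bounded : bounded_kernel k)
    (Hk : rkhs k)
    (P : probability (borel X) R)
    (d : measure_display) (Omega : measurableType d) (Pr : probability Omega R)
    (n : nat) (n_gt0 : (0 < n)%N)
    (Xs : 'I_n -> {RV Pr >-> borel X}) (Xs_iid : iid P Xs)
    (delta : R) (delta_gt0 : 0 < delta) (delta_lt1 : delta < 1) :
  let mu : Hk := mean_embedding Hk P in
  let muhat (t : nat) (w : Omega) : Hk :=
    empirical_embedding Hk (fun i => Xs i w) t in
  let v : R := embedding_variance Hk P in
  let kbar : R := kernel_bound k in
  let L : R := ln (2 / delta) in
  ((1 - delta)%:E <=
     Pr [set w | (\big[Num.max/0]_(1 <= t < n.+1) (t%:R * `|muhat t w - mu|)
                  <= Num.sqrt (2 * v * n%:R * L)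
                     + 4 / 3 * Num.sqrt kbar * L)%R])%E /\
  ((1 - delta)%:E <=
     Pr [set w | (`|muhat n w - mu|
                  <= Num.sqrt (2 * v * (L / n%:R))
                     + 4 / 3 * Num.sqrt kbar * (L / n%:R))%R])%E.
Proof.
move=> mu muhat v kbar L.
have [a [g [sg gm ga]]] := approximable_feature Hk X_separable k_continuous.
have aM j : `|rkhs_feature Hk (a j)| <= Num.sqrt kbar by exact: norm_feature_le.
have L0 : 0 < L by rewrite ln_gt0// ltr_pdivlMr// mul1r (lt_trans delta_lt1)// ltr1n.
have deltaE : 2 * expR (- L) = delta.
  by rewrite expRN lnK ?posrE ?divr_gt0// invf_div mulrCA divff ?mulr1.
pose phi : borel X -> Hk := rkhs_feature Hk.
have := iid_bernstein (@rkhs_dotE _ _ _ Hk) Xs_iid sg gm ga aM n_gt0 L0.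
rewrite deltaE -[bochner_integral P _]/mu.
have -> : fine (\int[P]_x (`|phi x - mu| ^+ 2)%:E)%E = v.
  by rewrite /v /embedding_variance unlock.
set r := Num.sqrt _ + _.
set E := [set w | _] => PrE.
have nR : 0 < n%:R :> R by rewrite ltr0n.
have v0 : 0 <= v.
  by rewrite /v /embedding_variance unlock fine_ge0// integral_ge0.
have r0 : 0 <= r by rewrite addr_ge0 ?sqrtr_ge0// !mulr_ge0 ?sqrtr_ge0// ltW.
have psE w t : (0 < t)%N -> (t <= n)%N ->
    t%:R * `|muhat t w - mu| =
    `|partial_sum (fun x => phi x - mu) (fun s => Xs s w) t|.
  move=> t0 tn; rewrite partial_sum_subcst// -[t%:R in LHS]ger0_norm// -normrZ.
  rewrite scalerBr /muhat /empirical_embedding scalerA mulfV ?scale1r//.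
  by rewrite pnatr_eq0 -lt0n.
have mphi : strongly_measurable (fun x => phi x - mu).
  exists (fun m x => rkhs_feature Hk (a (g m x)) - mu); split=> [m|x].
    exact: (simple_map_comp (fun j => rkhs_feature Hk (a j) - mu) (sg m)).
  by apply: cvgB (ga x) _; exact: cvg_cst.
have mE : measurable E by exact: measurable_max_exceeds.
have PrEC : ((1 - delta)%:E <= Pr (~` E))%E.
  by rewrite probability_setC// EFinB leeB.
split.
  rewrite (_ : [set w | _] = ~` E)//; apply/seteqP; split => w /=.
    move=> wr [t]; apply/negP; rewrite -leNgt.
    have [t0|t0] := posnP t.
      by rewrite t0 /partial_sum big1 ?normr0.
    have tn : (t <= n)%N by rewrite -ltnS.
    rewrite -psE//; apply: le_trans wr.
    apply: (@le_bigmax_seq _ _ _ _ _ (val t) xpredT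
      (fun t => t%:R * `|muhat t w - mu|)) => //.
    by rewrite mem_index_iota t0.
  move=> wE; rewrite big_nat_cond.
  apply: bigmax_le => // t /andP[/andP[t0 tn] _].
  rewrite psE// leNgt; apply/negP => rt; apply: wE.
  by exists (Ordinal tn).
have rn : Num.sqrt (2 * v * (L / n%:R)) + 4 / 3 * Num.sqrt kbar * (L / n%:R) = r / n%:R.
  rewrite /r [RHS]mulrDl; congr (_ + _); last by rewrite mulrA.
  apply: (canRL (mulfK _)); first by rewrite gt_eqF.
  rewrite -{2}(ger0_norm (ltW nR)) -sqrtr_sqr -sqrtrM ?mulr_ge0 ?invr_ge0 ?(ltW L0)//.
  by congr Num.sqrt; field; rewrite gt_eqF.
rewrite rn; apply: (le_trans PrEC); apply: le_measure.
- by rewrite inE; exact: measurableC.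
- rewrite inE (_ : [set w | _] = setT `&`
    (fun w => `|partial_sum (fun x => phi x - mu) (fun s => Xs s w) n|)
      @^-1` `]-oo, r]%classic).
    apply: measurable_norm_partial_sum => //; exact: measurable_itv.
  rewrite setTI; apply/seteqP; split => w /=;
    by rewrite in_itv/= -psE// ler_pdivlMr// mulrC.
- move=> w wE /=; rewrite ler_pdivlMr// mulrC psE// leNgt.
  by apply/negP => rt; apply: wE; exists ord_max.
Qed.
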